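(* Every noisy stochastic game (as defined in the context) has a coarser transition kernel; that is, there exist a probability measure $\lambda$ on $(S,\mathcal S)$ with $Q(\cdot|s,x)\ll\lambda$ for all $s\in S$, $x\in X$, a product measurable version $q(\cdot|s,x)$ of the Radon–Nikodym derivatives of $Q(\cdot|s,x)$ with respect to $\lambda$, and a sub-$\sigma$-algebra $\mathcal G$ of $\mathcal S$ such that $q(\cdot|s,x)$ is $\mathcal G$-measurable for all $s\in S$ and $x\in X$, and $\mathcal S$ has no $\mathcal G$-atom under $\lambda$.
   Context: **Noisy stochastic game.** The data are as follows. - $I=\{1,\dots,m\}$ is the set of players. For each $i\in I$, $X_i$ is a nonempty compact metric space; $X=\prod_iX_i$, $\mathcal B(X)=\bigotimes_i\mathcal B(X_i)$. - The state space is $S=H\times R$ with $\mathcal S=\mathcal H\otimes\mathcal R$, where $H$ and $R$ are complete separable metric spaces with Borel $\sigma$-algebras $\mathcal H$ and $\mathcal R$; $r\in R$ is the noise component. - For each $i$, $A_i$ is an $\mathcal S$-measurable, nonempty and compact valued correspondence from $S$ to $X_i$; $u_i:S\times X\to\mathbb R$ is bounded, $\mathcal S$-measurable in $s$ and continuous in $x$; $\beta_i\in[0,1)$ is a discount factor. - $Q:S\times X\times\mathcal S\to[0,1]$ is the transition probability ($Q(\cdot|s,x)$ is a probability measure on $(S,\mathcal S)$, $Q(E|\cdot,\cdot)$ is $\mathcal S\otimes\mathcal B(X)$-measurable). Let $Q_H(\cdot|s,x)$ be the marginal of $Q(\cdot|s,x)$ on $H$. There is a fixed probability measure $\kappa$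 on $(H,\mathcal H)$ such that for all $s,x$, $Q_H(\cdot|s,x)\ll\kappa$ with product measurable Radon–Nikodym derivative $\phi(\cdot|s,x)$. For each $s$, $Q_H(\cdot|s,x)$ is continuous in $x$ in total variation norm. - There is a transition probability $Q_R:H\times\mathcal R\to[0,1]$ such that for all $s\in S$, $x\in X$, $Z\in\mathcal S$, $$Q(Z|s,x)=\int_H\int_R\mathbf 1_Z(h',r')\,Q_R(dr'|h')\,Q_H(dh'|s,x).$$ - For every $h'\in H$, $Q_R(\cdot|h')$ is absolutely continuous with respect to an atomless probability measure $\nu$ on $(R,\mathcal R)$ (the same for all $h'$), with product measurable Radon–Nikodym derivative $\psi(\cdot|h')$. **$\mathcal G$-atoms.** Let $\mathcal G$ be a sub-$\sigma$-algebra of $\mathcal S$. For $D\in\mathcal S$ let $\mathcal G^D=\{D\cap D':D'\in\mathcal G\}$, $\mathcal S^D=\{D\cap D':D'\in\mathcal S\}$. A set $D\in\mathcal S$ with $\lambda(D)>0$ is a $\mathcal G$-atom (under $\lambda$) if $\{E\triangle E_0: E\in\mathcal G^D,\ E_0\in\mathcal S^D,\ \lambda(E_0)=0\}=\mathcal S^D$. *)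

(* Defs.v *)
From HB Require Import structures.
From mathcomp Require Import all_boot all_order all_algebra.
From mathcomp Require Import all_classical all_reals all_analysis.

Set Implicit Arguments.
Unset Strict Implicit.
Unset Printing Implicit Defensive.

Import Order.TTheory GRing.Theory Num.Theory.
Import numFieldNormedType.Exports.

Local Open Scope classical_set_scope.
Local Open Scope ring_scope.

(* Measurable types are pointed in the library, so nonemptiness of a metric
   space is expressed by a pointed structure. *)
#[short(type="pmetricType")]
HB.structure Definition PointedMetric (R : numDomainType) :=
  {T of Metric R T & Pointed T}.

#[short(type="completeMetricType")]
HB.structure Definition CompleteMetric (R : numDomainType) :=
  {T of Metric R T & Complete T}.

Definition separable_space (T : topologicalType) : Prop :=
  exists2 D : set T, countable D & dense D.

Notation borel T := (g_sigma_algebraType (@open T)).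

Section action_profiles.
Context {R : realType} {I : Type} (X : I -> pmetricType R).

Definition cylinders : set (set (prod_topology X)) :=
  \bigcup_(i in [set: I])
    preimage_set_system setT (fun x : prod_topology X => x i)
      (measurable : set (set (borel (X i)))).

End action_profiles.
Arguments cylinders {R I} X _.

(* The profiles with the product of the Borel sigma-algebras of the factors;
   their topology is that of the convertible type [prod_topology X]. *)
Notation profile X := (g_sigma_algebraType (cylinders X)).

(* The lower inverses of closed sets are measurable. For compact values in a
   metric space, testing open sets instead gives the same notion. *)
Definition measurable_correspondence d (T : measurableType d)
    (Y : topologicalType) (A : T -> set Y) : Prop :=
  forall C : set Y, closed C -> measurable [set t | A t `&` C !=set0].

Section measure_notions.
Local Open Scope ereal_scope.
Context d (T : measurableType d) (R : realType).
Implicit Types (mu nu : set T -> \bar R).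

Definition atomless mu : Prop :=
  forall A, measurable A -> 0 < mu A ->
    exists B, [/\ measurable B, B `<=` A, 0 < mu B & mu B < mu A].

(* [f] is a version of the Radon-Nikodym derivative of [nu] with respect
   to [mu]. *)
Definition is_density mu nu (f : T -> R) : Prop :=
  [/\ measurable_fun setT f, forall t, (0 <= f t)%R &
      forall A, measurable A -> nu A = \int[mu]_(t in A) (f t)%:E].

(* Meant for a finite signed measure, such as a difference of two
   probability measures: the supremum over all finite measurable partitions
   of the whole space. *)
Definition total_variation_norm nu : \bar R :=
  ereal_sup [set v | exists n (E : 'I_n -> set T),
    [/\ forall i, measurable (E i), trivIset setT E, \bigcup_i E i = setT &
        v = \sum_(i < n) `|nu (E i)| ]].

Definition is_atom_over (G : set (set T)) mu (D : set T) : Prop :=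
  [/\ measurable D, 0 < mu D &
      [set E `+` E0 | E in strace G D &
                      E0 in strace measurable D `&` [set E0 | mu E0 = 0]]
      = strace measurable D].

Definition sub_sigma_algebra_of (G : set (set T)) : Prop :=
  sigma_algebra setT G /\ G `<=` measurable.

End measure_notions.

Section noisy_games.
Local Open Scope ereal_scope.
Context {R : realType} {m : nat}.
Context (X : 'I_m -> pmetricType R) (H N : completeMetricType R).

Local Notation S := (borel H * borel N)%type.

Record noisy_stochastic_game := NoisyStochasticGame {
  actions_compact : forall i, compact [set: X i] ;
  hstates_separable : separable_space H ;
  noises_separable : separable_space N ;

  feasible : forall i, S -> set (X i) ;
  feasible_measurable : forall i, measurable_correspondence (@feasible i) ;
  feasible_nonempty : forall i s, @feasible i s !=set0 ;
  feasible_compact : forall i s, compact (@feasible i s) ;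

  payoff : 'I_m -> S -> profile X -> R ;
  payoff_bounded : forall i, exists M : R, forall s x, (`|payoff i s x| <= M)%R ;
  payoff_measurable : forall i x, measurable_fun setT (fun s => payoff i s x) ;
  payoff_continuous : forall i s, continuous (payoff i s : prod_topology X -> R) ;

  discount : 'I_m -> R ;
  discount_bounds : forall i, (0 <= discount i < 1)%R ;

  transition : R.-pker (S * profile X) ~> S ;
  hmarginal : S -> profile X -> set (borel H) -> \bar R :=
    fun s x => pushforward (transition (s, x)) fst ;
  hreference : probability (borel H) R ;
  hmarginal_dominated : forall s x, hmarginal s x `<< hreference ;
  hdensity : borel H * (S * profile X) -> R ;
  hdensity_measurable : measurable_fun setT hdensity ;
  hdensityP : forall s x,
    is_density hreference (hmarginal s x) (fun h => hdensity (h, (s, x))) ;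
  hmarginal_continuous : forall s (x : prod_topology X),
    total_variation_norm (fun E => hmarginal s y E - hmarginal s x E)
      @[y --> x] --> 0 ;

  noise_kernel : R.-pker (borel H) ~> (borel N) ;
  transition_decomposition : forall s x (Z : set S), measurable Z ->
    transition (s, x) Z =
    \int[hmarginal s x]_h \int[noise_kernel h]_r (\1_Z (h, r))%:E ;

  noise_reference : probability (borel N) R ;
  noise_reference_atomless : atomless noise_reference ;
  noise_dominated : forall h, noise_kernel h `<< noise_reference ;
  noise_density : borel N * borel H -> R ;
  noise_density_measurable : measurable_fun setT noise_density ;
  noise_densityP : forall h,
    is_density noise_reference (noise_kernel h)
      (fun r => noise_density (r, h))
}.

End noisy_games.

(* Main.v *)
Require Import Defs.
From HB Require Import structures.
From mathcomp Require Import all_boot all_order all_algebra.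
From mathcomp Require Import all_classical all_reals all_analysis.
From mathcomp Require Import measurable_realfun.

(** Take [lambda = kappa (x) Q_R], [q(h', r' | s, x) = phi(h' | s, x)] and for [G] the
    sigma-algebra of the sets [A * N] with [A] measurable in [H].  If [D] were a
    [G]-atom, then for each set [C] of a countable family of small open sets covering
    [N], almost every section [D_h] would be, up to a [Q_R(. | h)]-null set, either
    inside or disjoint from [C].  Intersecting those that carry [D_h] as their diameter
    tends to 0 would concentrate [D_h] on one point, which is [Q_R(. | h)]-null because
    [nu] is atomless; hence [lambda D = 0]. *)

Set Implicit Arguments.
Unset Strict Implicit.
Unset Printing Implicit Defensive.

Import Order.TTheory GRing.Theory Num.Theory.
Import numFieldNormedType.Exports.

Local Open Scope classical_set_scope.
Local Open Scope ring_scope.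

(** * Small countable covers and null sets *)

Lemma separable_small_covers (R : realType) (T : pseudoMetricType R) :
  separable_space T ->
  exists C : nat -> nat -> set T,
    [/\ forall k n, open (C k n), forall k, \bigcup_n C k n = setT &
        forall k n x y, C k n x -> C k n y ->
          ball x (k.+1%:R^-1 + k.+1%:R^-1) y].
Proof.
move=> [D cD dD]; have [f injf] := countable_injP _ cD.
(* [f] need not be onto: the union has at most one term, and [C k n] is empty when [n] codes no
   point of [D]. *)
exists (fun k n => \bigcup_(a in D `&` f @^-1` [set n]) (ball a k.+1%:R^-1)°).
split => [k n|k|k n x y [a [Da fa] xa] [b [Db fb] yb]].
- by apply: bigcup_open => a _; exact: open_interior.
- apply/seteqP; split => // x _.
  (* Half the radius, so that a whole ball around [x], and not only [x], lies in the ball around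
     [a]. *)
  have e0 : 0 < k.+1%:R^-1 / 2 :> R by rewrite divr_gt0// invr_gt0.
  have [] := dD (ball x (k.+1%:R^-1 / 2))°; [|exact: open_interior|].
    by exists x; exact: nbhsx_ballx.
  move=> a [/interior_subset xa Da]; exists (f a) => //; exists a => //.
  apply/nbhs_ballP; exists (k.+1%:R^-1 / 2) => // y xy.
  by apply: ball_split xy; exact: ball_sym.
- have ba : b = a by apply: injf; rewrite ?inE// fa fb.
  apply: (@ball_triangle _ _ a); first by apply/ball_sym; exact: interior_subset.
  by apply: interior_subset; rewrite -ba.
Qed.

(** If all pieces of [D] at some scale [k] are negligible, so is their countable union [D].
    Otherwise each scale has a piece [f k] that is not, so it carries almost all of [D], and [D]
    lies in [\bigcap_k C k (f k)] up to a negligible set. *)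
Lemma negligible_zero_one_covers d (T : measurableType d) (R : realType)
    (mu : {measure set T -> \bar R}) (C : nat -> nat -> set T) (D : set T) :
  (forall k, \bigcup_n C k n = setT) ->
  (forall k n, mu.-negligible (D `&` C k n) \/ mu.-negligible (D `\` C k n)) ->
  (forall f : nat -> nat, mu.-negligible (\bigcap_k C k (f k))) ->
  mu.-negligible D.
Proof.
move=> CT C01 C0.
have [[k Dk]|] := pselect (exists k, forall n, mu.-negligible (D `&` C k n)).
  by rewrite -(setIT D) -(CT k) setI_bigcupr; exact: negligible_bigcup.
move=> /forallNP C0N; have /choice[f fP] : forall k, exists n, ~ mu.-negligible (D `&` C k n).
  by move=> k; exact/existsNP/C0N.
have {}fP k : mu.-negligible (D `\` C k (f k)).
  by have [/fP|] := C01 k (f k).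
apply: negligibleS (negligibleU (negligible_bigcup fP) (C0 f)) => x Dx.
have [Cx|/existsNP[k /not_implyP[_ Ckx]]] := pselect (forall k, True -> C k (f k) x).
  by right.
by left; exists k.
Qed.

Lemma atomless_subsingleton d (T : measurableType d) (R : realType)
    (mu : {measure set T -> \bar R}) (A : set T) :
  atomless mu -> measurable A -> (forall x y, A x -> A y -> x = y) -> mu A = 0%E.
Proof.
move=> mu0 mA A1; apply/eqP; rewrite -measure_le0 leNgt; apply/negP.
move=> /(mu0 _ mA)[B [mB BA B0 BltA]]; move: B0; suff -> : B = set0.
  by rewrite measure0 ltxx.
apply/seteqP; split => // x Bx.
move: BltA; suff -> : A = B by rewrite ltxx.
apply/seteqP; split => // y Ay.
by rewrite (A1 y x) //; exact: BA.
Qed.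

(** * Integration against a measure with a density *)

Section density.
Local Open Scope ereal_scope.
Context d (T : measurableType d) (R : realType).
Variables (mu : {sigma_finite_measure set T -> \bar R})
  (nu : {measure set T -> \bar R}) (g : T -> R).
Hypotheses (nufin : fin_num_fun nu) (nug : is_density mu nu g).

(* [nu] under a name that can carry the finite measure structure. *)
Let nu' : set T -> \bar R := nu.
HB.instance Definition _ := Measure.on nu'.
HB.instance Definition _ := Measure_isFinite.Build _ _ _ nu' nufin.

(** By almost everywhere uniqueness, [g] agrees with the Radon-Nikodym derivative, for which the
    change of variables is known. *)
Lemma ge0_integral_density (f : T -> \bar R) :
  measurable_fun setT f -> (forall t, 0 <= f t) ->
  \int[nu]_t f t = \int[mu]_t (f t * (g t)%:E).
Proof.
move: nug => [mg g0 nuE] mf f0.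
have mgE : measurable_fun setT (EFin \o g) by exact/measurable_EFinP.
have numu : nu' `<< mu.
  apply/null_content_dominatesP => A mA A0.
  by rewrite [LHS]nuE// null_set_integral//; exact: measurable_funTS.
have gRN : ae_eq mu setT (Radon_Nikodym_SigmaFinite.f nu' mu) (EFin \o g).
  apply: integral_ae_eq => //.
    exact: Radon_Nikodym_SigmaFinite.f_integrable.
  by move=> A _ mA; rewrite -Radon_Nikodym_SigmaFinite.f_integral//= -nuE.
transitivity (\int[nu']_t f t) => //.
rewrite -(Radon_Nikodym_SigmaFinite.change_of_variables numu)//.
apply: ae_eq_integral => //.
- apply: emeasurable_funM => //.
  exact: measurable_int (Radon_Nikodym_SigmaFinite.f_integrable numu).
- exact: emeasurable_funM.
- exact: ae_eqe_mul2l.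
Qed.

End density.

(** * The semidirect product of a probability and a kernel *)

Section semidirect_product.
Local Open Scope ereal_scope.
Context d1 d2 (T1 : measurableType d1) (T2 : measurableType d2) (R : realType).
Variables (mu : probability T1 R) (k : R.-pker T1 ~> T2).

(* The kernel [h |-> delta_h (x) k h]; the dummy [unit] is required by [mkcomp]. *)
Let graph (x : unit * T1) : {measure set (T1 * T2) -> \bar R} :=
  measure_function_pushforward__canonical__measure_function_Measure
    (k x.2) (pair1_measurable x.2).

Let measurable_graph U :
  measurable U -> measurable_fun setT (graph ^~ U).
Proof.
move=> mU; rewrite (_ : graph ^~ U = (fun h => k h (xsection U h)) \o snd).
  apply: measurableT_comp => //.
  by apply: measurable_fun_xsection_finite_kernel; rewrite inE.
by apply/funext => -[u h] /=; rewrite /pushforward xsectionE.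
Qed.

HB.instance Definition _ := isKernel.Build _ _ _ _ _ graph measurable_graph.

Let graph_prob x : graph x setT = 1.
Proof. by rewrite /graph /= /pushforward preimage_setT prob_kernel. Qed.

HB.instance Definition _ :=
  Kernel_isProbability.Build _ _ _ _ _ graph graph_prob.

Let base : unit -> pprobability T1 R := cst mu.
Let mbase : measurable_fun setT base. Proof. exact: measurable_cst. Qed.

(** A composition of kernels started at the point [tt]: draw [h] from [mu], then [(h, r)] from
    [graph]. Iterated integration is thus inherited from [mkcomp]. *)
Definition semidirect : set (T1 * T2) -> \bar R :=
  mkcomp (kprobability mbase) graph tt.

HB.instance Definition _ := Measure.on semidirect.

Lemma semidirectE A : measurable A ->
  semidirect A = \int[mu]_h k h (xsection A h).
Proof.
by move=> mA; apply: eq_integral => h _ /=; rewrite /pushforward xsectionE.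
Qed.

Let semidirect_setT : semidirect setT = 1.
Proof.
rewrite semidirectE//; under eq_integral do
  rewrite xsectionE preimage_setT prob_kernel.
by rewrite integral_cst// mul1e; exact: probability_setT.
Qed.

HB.instance Definition _ :=
  Measure_isProbability.Build _ _ _ semidirect semidirect_setT.

Lemma ge0_integral_semidirect (f : T1 * T2 -> \bar R) :
  (forall z, 0 <= f z) -> measurable_fun setT f ->
  \int[semidirect]_z f z = \int[mu]_x \int[k x]_y f (x, y).
Proof.
move=> f0 mf; rewrite [LHS]integral_kcomp//.
by apply: eq_integral => h _; rewrite [LHS]ge0_integral_pushforward.
Qed.

End semidirect_product.

(** * Densities, null sets and atoms of the semidirect product *)

Section semidirect_theory.
Local Open Scope ereal_scope.
Context d1 d2 (T1 : measurableType d1) (T2 : measurableType d2) (R : realType).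
Variables (mu : probability T1 R) (k : R.-pker T1 ~> T2).

(** Changing the first marginal from [mu] to [nu] inserts the factor [g h] in the outer integral;
    being constant in [r], it moves inside the inner one. *)
Lemma integral_semidirect_density (nu : {measure set T1 -> \bar R})
    (g : T1 -> R) (Z : set (T1 * T2)) :
  fin_num_fun nu -> is_density mu nu g -> measurable Z ->
  \int[nu]_h \int[k h]_r (\1_Z (h, r))%:E =
  \int[semidirect mu k]_(t in Z) (g t.1)%:E.
Proof.
move=> nufin nug mZ; have [mg g0 _] := nug.
have indicE h : \int[k h]_r (\1_Z (h, r))%:E = k h (xsection Z h).
  rewrite integral_indic//; last first.
    by rewrite -[X in measurable X]xsectionE; exact: measurable_xsection.
  by rewrite setIT xsectionE.
under eq_integral do rewrite indicE.
rewrite (ge0_integral_density nufin nug)//; last first.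
  by apply: measurable_fun_xsection_finite_kernel; rewrite inE.
rewrite [RHS]integral_mkcond epatch_indic ge0_integral_semidirect//; last 2 first.
- by move=> t; apply: mule_ge0; rewrite lee_fin.
- apply: emeasurable_funM; apply/measurable_EFinP => //.
  exact: (measurableT_comp mg measurable_fst).
apply: eq_integral => h _ /=.
rewrite ge0_integralZl//; last 2 first.
- apply/measurable_EFinP.
  exact: (measurableT_comp (measurable_indic mZ) (pair1_measurable h)).
- by rewrite lee_fin.
by rewrite indicE muleC.
Qed.

Lemma semidirect_eq0 (A : set (T1 * T2)) : measurable A ->
  semidirect mu k A = 0 <-> {ae mu, forall h, k h (xsection A h) = 0}.
Proof.
move=> mA; rewrite semidirectE//.
rewrite (_ : \int[mu]_h _ = \int[mu]_h `|k h (xsection A h)|); last first.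
  by apply: eq_integral => h _; rewrite gee0_abs.
rewrite (ae_eq_integral_abs _ measurableT); last first.
  by apply: measurable_fun_xsection_finite_kernel; rewrite inE.
by split; apply: filterS => h //; exact.
Qed.

Lemma semidirect_no_atom_over_fst (C : nat -> nat -> set T2) (D : set (T1 * T2)) :
  (forall j n, measurable (C j n)) -> (forall j, \bigcup_n C j n = setT) ->
  (forall h f, (k h).-negligible (\bigcap_j C j (f j))) ->
  ~ is_atom_over (preimage_set_system setT fst measurable) (semidirect mu k) D.
Proof.
move=> mC CT C0 [mD D0 DE].
(* The atom property, applied to the trace on [D] of the cylinder over [C j n], gives a cylinder
   over some [A] in [T1] with the same trace up to a null set [E]. *)
have /choice[A /choice[E AE]] : forall jn : nat * nat, exists A E,
    [/\ measurable E, semidirect mu k E = 0 &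
        (fst @^-1` A `&` D) `+` E = snd @^-1` C jn.1 jn.2 `&` D].
  move=> [j n] /=.
  have : strace measurable D (snd @^-1` C j n `&` D).
    exists (snd @^-1` C j n) => //.
    by rewrite -[X in measurable X]setTI; exact: measurable_snd.
  rewrite -DE => -[_ [_ [A _ <-] <-] [_ [[E mE <-] E0] AE]].
  by exists A, (E `&` D); split; [exact: measurableI|exact: E0|rewrite -AE setTI].
suff : semidirect mu k D = 0 by move=> D0'; rewrite D0' ltxx in D0.
apply/semidirect_eq0 => //.
(* As the pairs [(j, n)] are countably many, one exceptional null set of [h] serves them all. *)
have : {ae mu, forall h, forall j n, k h (xsection (E (j, n)) h) = 0}.
  apply: ae_foralln => j; apply: ae_foralln => n.
  by have [mE E0 _] := AE (j, n); exact/semidirect_eq0.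
apply: filterS => h E0; apply/negligibleP; first exact: measurable_xsection.
apply: (negligible_zero_one_covers CT) => // j n.
have [mE _ /seteqP[AE1 AE2]] := AE (j, n).
have {E0} Eh : (k h).-negligible (xsection (E (j, n)) h).
  by apply/negligibleP; [exact: measurable_xsection|exact: E0].
(* A cylinder over [A] contains the whole fibre over [h] or misses it, hence the zero-one
   alternative up to the section of [E]. *)
have [Ah|nAh] := pselect (A (j, n) h); [right|left]; apply: negligibleS Eh.
- move=> y [/xsectionP Dy nCy]; apply/xsectionP; apply: contrapT => nEy.
  by apply: nCy; have [] := AE1 (h, y) (or_introl (conj (conj Ah Dy) nEy)).
- move=> y [/xsectionP Dy Cy]; apply/xsectionP.
  by have [[[]]|[]] := AE2 (h, y) (conj Cy Dy).
Qed.

End semidirect_theory.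

(** * The coarser transition kernel of a noisy game *)

Lemma eq_small_balls (R : realType) (T : metricType R) (x y : T) :
  (forall k, ball x (k.+1%:R^-1 + k.+1%:R^-1) y) -> x = y.
Proof.
move=> xy; apply/mdist_positivity/eqP; rewrite eq_le mdist_ge0 andbT leNgt.
apply/negP => d0.
have e0 : 0 < mdist x y / 2 by rewrite divr_gt0.
have [k _ /(_ k (leqnn k)) /= ke] := near_infty_natSinv_lt (PosNum e0).
have := xy k; rewrite ballEmdist /= ltNge => /negP; apply.
by rewrite (splitr (mdist x y)) lerD// ltW.
Qed.

Theorem proposition2 (R : realType) (m : nat) (X : 'I_m -> pmetricType R)
    (H N : completeMetricType R) (game : noisy_stochastic_game X H N) :
  exists (lambda : probability (borel H * borel N)%type R)
         (q : (borel H * borel N) * ((borel H * borel N) * profile X) -> R)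
         (G : set (set (borel H * borel N))),
    [/\ forall s x, transition game (s, x) `<< lambda,
        measurable_fun setT q /\
        (forall s x, is_density lambda (transition game (s, x))
                       (fun t => q (t, (s, x)))),
        sub_sigma_algebra_of G,
        forall s x, measurable_fun (setT : set (g_sigma_algebraType G))
                      (fun t => q (t, (s, x))) &
        forall D, ~ is_atom_over G lambda D].
Proof.
pose lambda : probability (borel H * borel N)%type R :=
  semidirect (hreference game) (noise_kernel game).
pose q (p : (borel H * borel N) * ((borel H * borel N) * profile X)) :=
  hdensity game (p.1.1, p.2).
pose G : set (set (borel H * borel N)) :=
  preimage_set_system setT fst measurable.
have mq : measurable_fun setT q.
  apply: measurableT_comp; first exact: hdensity_measurable.
  apply: measurable_fun_pair => //.
  by apply: measurableT_comp.
have lambda_density s x :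
    is_density lambda (transition game (s, x)) (fun t => q (t, (s, x))).
  have [mphi phi0 _] := hdensityP game s x.
  have mqsx : measurable_fun setT (fun t => q (t, (s, x))).
    exact: (measurableT_comp mphi measurable_fst).
  split => // [t|Z mZ]; first exact: phi0.
  (* [hm] is [hmarginal game s x] equipped with its measure structure. *)
  pose hm : {measure set (borel H) -> \bar R} :=
    measure_function_pushforward__canonical__measure_function_Measure
      (transition game (s, x)) measurable_fst.
  have hmfin : fin_num_fun hm.
    apply: lty_fin_num_fun; rewrite /hm /= /pushforward preimage_setT.
    by rewrite prob_kernel ltry.
  rewrite transition_decomposition//.
  exact: (integral_semidirect_density _ hmfin (hdensityP game s x)).
exists lambda, q, G; split.
- move=> s x; apply/null_content_dominatesP => A mA A0.
  have [mqsx _ ->//] := lambda_density s x.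
  rewrite null_set_integral//; apply: measurable_funTS.
  exact/measurable_EFinP.
- by [].
- split; first exact/sigma_algebra_preimage/sigma_algebra_measurable.
  move=> _ [A mA <-]; exact: measurable_fst.
(* The preimage of [B] under [q] is the cylinder over its preimage under the density on [H]. *)
- move=> s x _ B mB; rewrite setTI; apply: sub_sigma_algebra.
  have [mphi _ _] := hdensityP game s x.
  exists ((fun h => hdensity game (h, (s, x))) @^-1` B); last by rewrite setTI.
  by rewrite -[X in measurable X]setTI; exact: mphi.
- move=> D; have [C [oC CT Cball]] := separable_small_covers (noises_separable game).
  have mC j n : measurable (C j n : set (borel N)).
    exact: sub_sigma_algebra.
  (* Points of [\bigcap_j C j (f j)] are within [2 / (j + 1)] of each other for all [j], so there is
     at most one; it is null for the atomless reference, hence for the noise kernel at every [h]. *)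
  apply: (semidirect_no_atom_over_fst mC CT) => h f.
  have mI : measurable (\bigcap_j C j (f j) : set (borel N)).
    exact: bigcapT_measurable.
  apply/negligibleP => //.
  apply: ((null_content_dominatesP _ _).1 _ _ mI).
    exact: (@noise_dominated _ _ _ _ _ game h).
  apply: (atomless_subsingleton (@noise_reference_atomless _ _ _ _ _ game) mI).
  move=> x y Cx Cy; apply: eq_small_balls => j.
  by apply: Cball; [exact: Cx|exact: Cy].
Qed.
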